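(* Let $m\ge1$ and $\kappa_m=\sqrt{\ln(4m)/\pi}$. The average number of nodes of the minimal dag of an $m$-labeled binary tree of size $n$, taken uniformly at random, satisfies $$\bar N^{\mathcal B}_{m,n}=2\kappa_m\frac{n}{\sqrt{\ln n}}\left(1+O\!\left(\frac1{\ln n}\right)\right)\quad(n\to\infty).$$
   Context: An $m$-labeled binary tree is a non-empty finite rooted tree with node labels in $\{1,\dots,m\}$ in which every node has an optional left and an optional right child (distinguished); its size is its number of edges. The number of nodes of its minimal dag is the number of distinct subtrees (subtree = a node with all its descendants). $\bar N^{\mathcal B}_{m,n}$ is the average of this quantity over all $m$-labeled binary trees of size $n$. *)

(* Defs.v *)
From HB Require Import structures.
From mathcomp Require Import all_boot.
From Stdlib Require Import Reals.

Set Implicit Arguments.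
Unset Strict Implicit.
Unset Printing Implicit Defensive.

(* Binary trees with an explicit empty subtree [Leaf].  A (non-empty)
   labeled binary tree is a term of the form [Node a l r]; [Leaf] encodes an
   absent left/right child.  Labels are natural numbers. *)
Inductive btree := Leaf | Node of nat & btree & btree.

Fixpoint btree_eqb (s t : btree) : bool :=
  match s, t with
  | Leaf, Leaf => true
  | Node a l r, Node b l' r' => (a == b) && btree_eqb l l' && btree_eqb r r'
  | _, _ => false
  end.

Lemma btree_eqP : Equality.axiom btree_eqb.
Proof.
elim=> [|a l IHl r IHr] [|b l' r'] /=; try by constructor.
case: eqP => [<-|neq] /=; last by constructor; case.
case: (IHl l') => [<-|neq] /=; last by constructor; case.
case: (IHr r') => [<-|neq] /=; last by constructor; case.
by constructor.
Qed.

HB.instance Definition _ := hasDecEq.Build btree btree_eqP.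

Fixpoint nnodes (t : btree) : nat :=
  match t with Leaf => 0 | Node _ l r => (nnodes l + nnodes r).+1 end.

Fixpoint subtrees (t : btree) : seq btree :=
  match t with Leaf => [::] | Node _ l r => t :: (subtrees l ++ subtrees r) end.

(* number of nodes of the minimal dag = number of distinct subtrees *)
Definition dag_nodes (t : btree) : nat := size (undup (subtrees t)).

(* all trees (including Leaf) of height <= d with labels in {1,...,m};
   each such tree occurs exactly once *)
Fixpoint trees_h (m d : nat) : seq btree :=
  match d with
  | 0 => [:: Leaf]
  | d'.+1 => let T := trees_h m d' in
    Leaf :: [seq Node a lr.1 lr.2 | a <- iota 1 m, lr <- [seq (l, r) | l <- T, r <- T]]
  end.

(* all m-labeled binary trees of size n (n edges, i.e. n+1 nodes);
   such a tree has height <= n+1, so enumerating height <= n+1 suffices *)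
Definition labeled_trees (m n : nat) : seq btree :=
  [seq t <- trees_h m n.+1 | (t != Leaf) && (nnodes t == n.+1)].

Definition Nbar (m n : nat) : R :=
  (INR (sumn (map dag_nodes (labeled_trees m n))) / INR (size (labeled_trees m n)))%R.

Definition kappa (m : nat) : R := sqrt (ln (4 * INR m) / PI).

(* Main.v *)
From Stdlib Require Import Reals Lra Lia.
From Coquelicot Require Import Coquelicot.
Require Import Defs.
From mathcomp Require Import all_boot.
From mathcomp Require Import zify.

Set Implicit Arguments.
Unset Strict Implicit.
Unset Printing Implicit Defensive.

(**
Let [N = n + 1] be the number of nodes and [X_u] the number of occurrences of a
tree [u] with [k] nodes as a subtree of a random tree with [N] nodes.  Marking
one or two absent children where copies of [u] are grafted gives the exact values
[sum_t X_u(t) = m^(N-k) 'C(2(N-k), N-k)] and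
[sum_t X_u(t) (X_u(t) - 1) = m^(N-2k) (N-2k) 'C(2(N-2k), N-2k)].
From [X - X (X - 1) / 2 <= [X > 0] <= min(1, X)], applied to all [u] with at least
[K] nodes, the average differs from the expected number [M_K] of subtrees with at
least [K] nodes by at most the number of trees with fewer than [K] nodes, or by
the expected number of equal pairs.  For [K] the integer part of [ln n / ln (4m)]
both are [O(n / K^(3/2))].  A telescoping sum gives
[M_K = (2(N-K)+1) B_K B_(N-K) / B_N] with [B_k = 'C(2k, k) / 4^k], and Wallis'
bounds [1 / sqrt (PI (k+1)) <= B_k <= 1 / sqrt (PI k)] finish the proof.
*)

Local Open Scope nat_scope.

(** * Central binomial coefficients and Catalan numbers *)

Definition cbin (k : nat) := 'C(k.*2, k).
(** The ballot form of the Catalan numbers avoids a division in [nat]; [catalanM] recovers the usual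
    quotient. *)
Definition catalan (k : nat) := cbin k - 'C(k.*2, k.+1).

Lemma cbinS k : k.+1 * cbin k.+1 = 2 * k.*2.+1 * cbin k.
Proof.
rewrite /cbin doubleS.
have sym : 'C(k.*2.+1, k) = 'C(k.*2.+1, k.+1).
  by rewrite -bin_sub; [congr 'C(_, _); lia | lia].
by rewrite -mul_bin_diag /= sym -doubleS -mul2n -!mulnA -mul_bin_diag.
Qed.

Lemma catalanM k : k.+1 * catalan k = cbin k.
Proof.
rewrite /catalan mulnBr /cbin mul_bin_left.
have -> : k.*2 - k = k by lia.
nia.
Qed.

Lemma cbin_gt0 k : 0 < cbin k.
Proof. rewrite bin_gt0; lia. Qed.

(* Telescopes: [(2j+1) cbin K cbin j] with [K + j] fixed decreases by
   [(K+j+1) catalan K cbin j] when [K] increases by one. *)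
Lemma catalan_cbin_sum j K :
  (K + j).+1 * \sum_(i < j.+1) catalan (K + j - i) * cbin i
  = j.*2.+1 * cbin K * cbin j.
Proof.
elim: j K => [|j IHj] K.
  by rewrite big_ord1 addn0 subn0 mul1n mulnA catalanM.
rewrite big_ord_recr /= addnK mulnDr -addSnnS.
have {}IHj := IHj K.+1.
rewrite IHj.
have eK := cbinS K; have ej := cbinS j; have eC := catalanM K.
apply/eqP; rewrite -(eqn_pmul2l (ltn0Sn K)); apply/eqP.
rewrite mulnDr.
have -> : K.+1 * (j.*2.+1 * cbin K.+1 * cbin j)
  = (K.+1 * cbin K.+1) * (j.*2.+1 * cbin j) by lia.
have -> : K.+1 * ((K.+1 + j).+1 * (catalan K * cbin j.+1))
  = (K + j).+2 * (K.+1 * catalan K) * cbin j.+1 by lia.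
rewrite eK eC.
have -> : 2 * K.*2.+1 * cbin K * (j.*2.+1 * cbin j)
  = K.*2.+1 * cbin K * (2 * j.*2.+1 * cbin j) by lia.
rewrite -ej; move: (cbin K) (cbin j.+1) => x y.
nia.
Qed.

(** In generating functions this is 2xBC = B - 1. It is the case [K = 0] of [catalan_cbin_sum], and
    will be matched with the recurrence for occurrences. *)
Lemma cbin_conv J : 2 * \sum_(i < J.+1) cbin i * catalan (J - i) = cbin J.+1.
Proof.
have h := catalan_cbin_sum J 0.
have e : \sum_(i < J.+1) cbin i * catalan (J - i)
  = \sum_(i < J.+1) catalan (0 + J - i) * cbin i.
  by apply: eq_bigr => i _; rewrite mulnC.
rewrite e; apply/eqP; rewrite -(eqn_pmul2l (ltn0Sn J)) cbinS.
rewrite mulnCA h /cbin double0 bin0; apply/eqP; lia.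
Qed.

(** Multiply by J + 2 = (i + 1) + (J - i + 1): by the symmetry i -> J - i, both parts give the sum
    in [cbin_conv]. *)
Lemma catalan_conv J : \sum_(i < J.+1) catalan i * catalan (J - i) = catalan J.+1.
Proof.
set S := \sum_(i < _) _.
have h : (J.+2) * S = cbin J.+1.
  rewrite -cbin_conv mul2n -addnn.
  rewrite [X in _ = X + _](reindex_inj rev_ord_inj) /= -big_split /= big_distrr /=.
  apply: eq_bigr => i _.
  have hi := ltn_ord i.
  rewrite subSS (_ : J - (J - i) = i); last lia.
  rewrite -(catalanM i) -(catalanM (J - i)).
  move: (catalan i) (catalan (J - i)) => x y.
  have -> : J.+2 = i.+1 + (J - i).+1 by lia.
  lia.
apply/eqP; rewrite -(eqn_pmul2l (ltn0Sn J.+1)) h catalanM //.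
Qed.

(** By [catalanM] each summand equals [(J + 1) cbin i catalan (J - i)]. This will be matched with
    the recurrence for pairs of occurrences. *)
Lemma cbin_pair_conv J :
  2 * \sum_(i < J.+1) (i * cbin i * catalan (J - i) + cbin i * cbin (J - i))
  = J.+1 * cbin J.+1.
Proof.
rewrite -cbin_conv mulnCA; congr (2 * _).
rewrite big_distrr /=; apply: eq_bigr => i _.
have hi := ltn_ord i.
rewrite -(catalanM (J - i)).
move: (cbin i) (catalan (J - i)) => x y.
have e : J.+1 = i + (J - i).+1 by lia.
rewrite [X in _ = X * _]e; lia.
Qed.

(** * Enumeration of trees by number of nodes *)

Fixpoint well_labeled (m : nat) (t : btree) : bool :=
  if t is Node a l r then [&& 0 < a <= m, well_labeled m l & well_labeled m r]
  else true.

Lemma uniq_trees_h m d : uniq (trees_h m d).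
Proof.
elim: d => [//|d IHd] /=; apply/andP; split.
  by apply/negP => /allpairsP[[a lr]] [].
apply: allpairs_uniq; first exact: iota_uniq.
  by apply: allpairs_uniq => // -[? ?] [? ?].
by move=> [a [l r]] [b [l' r']] _ _ /= [-> -> ->].
Qed.

(** The height of a tree never exceeds its number of nodes, so depth [d] reaches every tree with at
    most [d] nodes. *)
Lemma mem_trees_h m d t :
  nnodes t <= d -> (t \in trees_h m d) = well_labeled m t.
Proof.
elim: d t => [|d IHd] [|a l r] //=; rewrite ltnS => hd.
rewrite inE /=; apply/idP/idP.
  move/allpairsP=> [[b [l' r']]] /= [hb /allpairsP[[x y] /= [hx hy [-> ->]]] [ea el er]].
  subst b x y; rewrite -!IHd ?hx ?hy ?andbT; [|lia..].
  by move: hb; rewrite mem_iota; lia.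
case/and3P=> ha hl hr; apply/allpairsP; exists (a, (l, r)) => /=; split=> //.
  by rewrite mem_iota; lia.
apply/allpairsP; exists (l, r) => /=; split=> //; rewrite IHd //; lia.
Qed.

Definition trees_of (m N : nat) := [seq t <- trees_h m N | nnodes t == N].

Lemma mem_trees_of m N t :
  (t \in trees_of m N) = (nnodes t == N) && well_labeled m t.
Proof.
rewrite mem_filter; case: eqP => //= <-; exact: mem_trees_h.
Qed.

Lemma uniq_trees_of m N : uniq (trees_of m N).
Proof. exact/filter_uniq/uniq_trees_h. Qed.

(** Unfolding [trees_h] at the root lists both children at the same depth bound, whatever their
    size; this lemma moves them to their own enumeration. *)
Lemma perm_trees_of m N d : N <= d ->
  perm_eq [seq t <- trees_h m d | nnodes t == N] (trees_of m N).
Proof.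
move=> hN; apply: uniq_perm; rewrite ?uniq_trees_of //.
  exact/filter_uniq/uniq_trees_h.
move=> t; rewrite mem_trees_of mem_filter; case: eqP => //= e.
by rewrite mem_trees_h // e.
Qed.

Lemma labeled_treesE m n : labeled_trees m n = trees_of m n.+1.
Proof. by apply: eq_filter => -[]. Qed.

Lemma sum_trees_ofS m N (F : btree -> nat) :
  \sum_(t <- trees_of m N.+1) F t
  = \sum_(a <- iota 1 m) \sum_(i < N.+1)
      \sum_(l <- trees_of m i) \sum_(r <- trees_of m (N - i)) F (Node a l r).
Proof.
rewrite big_filter /= big_cons /= big_mkcond big_allpairs_dep /=.
apply: eq_bigr => a _; rewrite big_allpairs_dep /=.
under eq_bigr => l _.
  (* Only the index [i = nnodes l] contributes on the right; if [l] has more than [N] nodes, both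
     sides are 0. *)
  have -> : \sum_(r <- trees_h m N)
      (if (nnodes l + nnodes r).+1 == N.+1 then F (Node a l r) else 0)
    = \sum_(i < N.+1) if nnodes l == i then
        \sum_(r <- trees_of m (N - i)) F (Node a l r) else 0.
    case: (leqP (nnodes l) N) => hl; last first.
      rewrite !big1 // => [i _|r _].
        by case: eqP => // e; have := ltn_ord i; lia.
      by case: eqP => // e; lia.
    rewrite (bigD1 (Ordinal (hl : nnodes l < N.+1))) //= eqxx.
    rewrite [X in _ = _ + X]big1 ?addn0 => [|i hi]; last first.
      case: eqP => // e; case/eqP: hi; exact: val_inj.
    rewrite -(perm_big _ (@perm_trees_of m (N - nnodes l) N (leq_subr _ _))) /=.
    rewrite big_filter -big_mkcond; apply: eq_bigl => r.
    by apply/eqP/eqP; lia.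
  over.
rewrite exchange_big /=; apply: eq_bigr => i _.
rewrite -big_mkcond -[in LHS]big_filter; apply: perm_big.
by apply: perm_trees_of; rewrite -ltnS.
Qed.

Lemma sum_nat_const_seq (T : Type) (s : seq T) x : \sum_(a <- s) x = size s * x.
Proof. by rewrite big_const_seq count_predT iter_addn_0 mulnC. Qed.

Lemma sum_bool_count (T : Type) (s : seq T) (p : pred T) :
  \sum_(x <- s) (p x : nat) = count p s.
Proof. by rewrite -sum1_count [RHS]big_mkcond; apply: eq_bigr => x _; case: (p x). Qed.

Lemma sum_iota_const m x : \sum_(a <- iota 1 m) x = m * x.
Proof. by rewrite sum_nat_const_seq size_iota. Qed.

Lemma size_trees_of m N : size (trees_of m N) = m ^ N * catalan N.
Proof.
elim/ltn_ind: N => -[|N] IHN //.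
rewrite -sum1_size sum_trees_ofS sum_iota_const -catalan_conv expnS -mulnA.
congr (m * _); rewrite big_distrr /=; apply: eq_bigr => i _.
have hi := ltn_ord i.
under eq_bigr do rewrite sum1_size.
rewrite big_const_seq count_predT iter_addn_0 !IHN; [|lia..].
have -> : m ^ N = m ^ i * m ^ (N - i) by rewrite -expnD; congr (m ^ _); lia.
lia.
Qed.

(** * Occurrences of a fixed subtree *)

Definition occ (u t : btree) := count_mem u (subtrees t).

Lemma nnodes_subtree u t : u \in subtrees t -> nnodes u <= nnodes t.
Proof.
elim: t => //= a l IHl r IHr; rewrite inE mem_cat => /orP[/eqP -> //|/orP[h|h]].
  by have := IHl h; lia.
by have := IHr h; lia.
Qed.

Lemma occ_small u t : nnodes t < nnodes u -> occ u t = 0.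
Proof.
move=> h; apply/count_memPn/negP => /nnodes_subtree; lia.
Qed.

Lemma occ_Node u a l r : occ u (Node a l r) = (Node a l r == u) + (occ u l + occ u r).
Proof. by rewrite /occ /= count_cat. Qed.

(* When [Node a l r = u], neither child contains [u], so both sides vanish. *)
Lemma occ_pairs_Node u a l r :
  occ u (Node a l r) * (occ u (Node a l r)).-1
  = occ u l * (occ u l).-1 + occ u r * (occ u r).-1 + 2 * (occ u l * occ u r).
Proof.
rewrite occ_Node; case: eqP => [<-|_]; first by rewrite !occ_small //=; lia.
rewrite add0n; case: (occ u l) => [|x]; case: (occ u r) => [|y]; nia.
Qed.

Lemma sum_trees_of_add (m i j : nat) (F G : btree -> nat) :
  \sum_(l <- trees_of m i) \sum_(r <- trees_of m j) (F l + G r)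
  = (\sum_(l <- trees_of m i) F l) * size (trees_of m j)
    + size (trees_of m i) * \sum_(r <- trees_of m j) G r.
Proof.
under eq_bigr do rewrite big_split /= big_const_seq count_predT iter_addn_0.
by rewrite big_split /= big_distrl /= big_const_seq count_predT iter_addn_0 mulnC
  [X in _ + X]mulnC mulnC.
Qed.

Lemma sum_rev (f g : nat -> nat) N :
  \sum_(i < N.+1) f i * g (N - i) = \sum_(i < N.+1) g i * f (N - i).
Proof.
rewrite (reindex_inj rev_ord_inj) /=; apply: eq_bigr => i _.
have hi := ltn_ord i.
by rewrite subSS (_ : N - (N - i) = i); [rewrite mulnC | lia].
Qed.

Lemma sum_shift (F : nat -> nat) h j : (forall i, i < h -> F i = 0) ->
  \sum_(i < (h + j).+1) F i = \sum_(i < j.+1) F (h + i).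
Proof.
move=> F0; rewrite -addnS big_split_ord /= big1 ?add0n // => i _.
exact: F0.
Qed.

Section Occurrences.
Variables (m k : nat) (u : btree).
Hypotheses (k_gt0 : 0 < k) (u_in : u \in trees_of m k).

Let c N := size (trees_of m N).
Let O N := \sum_(t <- trees_of m N) occ u t.
(** The product counts ordered pairs of distinct occurrences of [u]. *)
Let P N := \sum_(t <- trees_of m N) occ u t * (occ u t).-1.

Lemma nnodes_u : nnodes u = k.
Proof. by move: u_in; rewrite mem_trees_of => /andP[/eqP]. Qed.

(** The boolean term is the occurrence at the root, which only the tree [u] itself has. The left and
    right children contribute equally, whence the factor 2. *)
Lemma occ_rec N : O N.+1 = (N.+1 == k) + 2 * m * \sum_(i < N.+1) O i * c (N - i).
Proof.
have -> : O N.+1 = \sum_(t <- trees_of m N.+1) (t == u)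
   + \sum_(t <- trees_of m N.+1) (if t is Node _ l r then occ u l + occ u r else 0).
  rewrite -big_split /=; apply: eq_big_seq => -[|a l r].
    by rewrite mem_trees_of.
  by rewrite occ_Node.
congr (_ + _).
  rewrite (sum_bool_count _ (pred1 u)) count_uniq_mem ?uniq_trees_of // mem_trees_of nnodes_u.
  by move: u_in; rewrite mem_trees_of => /andP[_ ->]; rewrite andbT eq_sym.
rewrite sum_trees_ofS sum_iota_const mulnAC mulnC; congr (_ * _).
under eq_bigr do rewrite sum_trees_of_add.
by rewrite big_split /= (sum_rev c O) mul2n addnn.
Qed.

Lemma sum_occ_small N : N < k -> O N = 0.
Proof.
move=> hN; apply: big1_seq => t /=.
rewrite mem_trees_of => /andP[/eqP ht _]; apply: occ_small.
by rewrite ht nnodes_u.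
Qed.

(** Shifted by [k], the recurrence [occ_rec] is [cbin_conv] with a factor [m] per node, started at
    1. Hence only the size of [u] matters. *)
Lemma sum_occ j : O (k + j) = m ^ j * cbin j.
Proof.
have [k' ek] : exists k', k = k'.+1 by exists k.-1; lia.
elim/ltn_ind: j => -[|j] IHj.
  rewrite addn0 {1}ek occ_rec -ek eqxx big1 ?muln0 // => i _.
  by rewrite sum_occ_small // ek.
rewrite addnS occ_rec (_ : (_ == k) = false); last by apply/eqP; lia.
rewrite add0n (sum_shift (F := fun i => O i * c (k + j - i))) => [|i hi]; last by rewrite sum_occ_small.
rewrite -cbin_conv expnS -!mulnA [2 * _]mulnCA; congr (m * _).
rewrite mulnCA; congr (2 * _); rewrite big_distrr /=; apply: eq_bigr => i _.
have hi := ltn_ord i.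
rewrite IHj // /c size_trees_of (_ : k + j - (k + i) = j - i); last lia.
have -> : m ^ j = m ^ i * m ^ (j - i) by rewrite -expnD; congr (m ^ _); lia.
lia.
Qed.

Lemma occ_pairs_rec N :
  P N.+1 = 2 * m * \sum_(i < N.+1) (P i * c (N - i) + O i * O (N - i)).
Proof.
rewrite /P sum_trees_ofS.
under eq_bigr => a _ do under eq_bigr => i _ do under eq_bigr => l _ do
  under eq_bigr => r _ do rewrite occ_pairs_Node.
rewrite sum_iota_const mulnAC mulnC; congr (_ * _).
under eq_bigr => i _.
  under eq_bigr do rewrite big_split.
  rewrite big_split /= sum_trees_of_add.
  under [X in _ + X]eq_bigr do rewrite -!big_distrr.
  rewrite -[X in _ + X]big_distrr -big_distrl /=.
  over.
by rewrite !big_split /= (sum_rev c P) big1_eq addn0 addnA mulnDr !mul2n -!addnn addnA.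
Qed.

(** Distinct occurrences of one tree are disjoint, so a pair needs [2k] nodes. In the recurrence,
    one of [i] and [N - i] is always below [k]. *)
Lemma sum_occ_pairs_small N : N < k.*2 -> P N = 0.
Proof.
elim/ltn_ind: N => -[|N] IHN hN.
  rewrite /P; apply: big1_seq => t /=.
  rewrite mem_trees_of => /andP[/eqP ht _]; rewrite occ_small // nnodes_u; lia.
rewrite occ_pairs_rec big1 ?muln0 // => i _; have hi := ltn_ord i.
rewrite IHN; [|lia..].
case: (ltnP i k) => hik; first by rewrite sum_occ_small.
rewrite (sum_occ_small (N := N - i)) ?muln0 //; lia.
Qed.

(** The shift by [2k] turns [occ_pairs_rec] into [cbin_pair_conv], with the products of occurrence
    counts given by [sum_occ]. *)
Lemma sum_occ_pairs j : P (k.*2 + j) = m ^ j * (j * cbin j).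
Proof.
elim/ltn_ind: j => -[|j] IHj.
  have -> : k.*2 + 0 = (k.*2.-1).+1 by lia.
  rewrite occ_pairs_rec big1 ?muln0 // => i _; have hi := ltn_ord i.
  rewrite sum_occ_pairs_small; last lia.
  case: (ltnP i k) => hik; first by rewrite sum_occ_small.
  rewrite (sum_occ_small (N := k.*2.-1 - i)) ?muln0 //; lia.
rewrite addnS occ_pairs_rec -cbin_pair_conv expnS -!mulnA [2 * _]mulnCA; congr (m * _).
rewrite [in RHS]mulnCA; congr (2 * _); rewrite !big_split /=.
rewrite (sum_shift (F := fun i => P i * c (k.*2 + j - i))) => [|i hi]; last first.
  by rewrite sum_occ_pairs_small.
have -> : \sum_(i < (k.*2 + j).+1) O i * O (k.*2 + j - i)
    = \sum_(i < j.+1) O (k + i) * O (k + (j - i)).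
  (* A child with fewer than [k] nodes contains no copy of [u], which trims [k] terms at each end of
     the sum. *)
  rewrite (_ : k.*2 + j = k + (j + k)); last lia.
  rewrite (sum_shift (F := fun i => O i * O (k + (j + k) - i))); last first.
    by move=> i hi; rewrite sum_occ_small.
  rewrite -addSn big_split_ord /= [X in _ + X]big1 => [|i _]; last first.
    rewrite (sum_occ_small (N := k + (j + k) - (k + (j.+1 + i)))) ?muln0 //; lia.
  rewrite addn0; apply: eq_bigr => i _; have hi := ltn_ord i.
  congr (_ * O _); lia.
rewrite mulnDr !big_distrr /=; congr (_ + _); apply: eq_bigr => i _.
  have hi := ltn_ord i.
  rewrite IHj // /c size_trees_of (_ : k.*2 + j - (k.*2 + i) = j - i); last lia.
  have -> : m ^ j = m ^ i * m ^ (j - i) by rewrite -expnD; congr (m ^ _); lia.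
  lia.
have hi := ltn_ord i.
rewrite !sum_occ.
have -> : m ^ j = m ^ i * m ^ (j - i) by rewrite -expnD; congr (m ^ _); lia.
lia.
Qed.

End Occurrences.

Lemma well_labeled_subtree m u t :
  well_labeled m t -> u \in subtrees t -> well_labeled m u.
Proof.
elim: t => //= a l IHl r IHr /and3P[ha hl hr].
rewrite inE mem_cat => /orP[/eqP -> /=|/orP[]]; [exact/and3P | exact: IHl | exact: IHr].
Qed.

(** Group the distinct subtrees by number of nodes; subtrees inherit the label bound, so each group
    is a part of [trees_of m k]. *)
Lemma dag_nodesE m N t : t \in trees_of m N ->
  dag_nodes t = \sum_(0 <= k < N.+1) \sum_(u <- trees_of m k) (u \in subtrees t).
Proof.
rewrite mem_trees_of => /andP[/eqP ht wt].
have -> : dag_nodes t = \sum_(0 <= k < N.+1) count (fun u => nnodes u == k) (undup (subtrees t)).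
  under eq_bigr do rewrite -sum1_count big_mkcond.
  rewrite exchange_big /dag_nodes -sum1_size /=.
  apply: eq_big_seq => u; rewrite mem_undup => hu.
  have hN : nnodes u < N.+1 by rewrite -ht ltnS nnodes_subtree.
  rewrite big_mkord (bigD1 (Ordinal hN)) //= eqxx big1 // => i hi.
  by case: eqP => // e; case/eqP: hi; apply: val_inj.
apply: eq_bigr => k _.
rewrite (sum_bool_count _ [in subtrees t]) -!size_filter; apply/perm_size/uniq_perm.
- exact/filter_uniq/undup_uniq.
- exact/filter_uniq/uniq_trees_of.
move=> u; rewrite [LHS]mem_filter [RHS]mem_filter mem_undup mem_trees_of /=.
case: eqP => //= _; case hu: (u \in _) => //=.
  by rewrite (well_labeled_subtree wt hu).
Qed.

(** * Bounds on the number of distinct subtrees *)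

Definition dag_sum (m N : nat) := \sum_(t <- trees_of m N) dag_nodes t.

Lemma dag_sumE m N : dag_sum m N =
  \sum_(0 <= k < N.+1) \sum_(u <- trees_of m k) \sum_(t <- trees_of m N) (u \in subtrees t).
Proof.
rewrite /dag_sum (eq_big_seq _ (@dag_nodesE m N)) exchange_big /=.
by apply: eq_bigr => k _; rewrite exchange_big.
Qed.

(** Below size [K] the indicator of occurrence is bounded by 1, from [K] on by the number of
    occurrences. *)
Lemma dag_sum_le m N K : 0 < K <= N ->
  dag_sum m N <= size (trees_of m N) * (\sum_(0 <= k < K) size (trees_of m k))
   + \sum_(K <= k < N.+1) size (trees_of m k) * (m ^ (N - k) * cbin (N - k)).
Proof.
move=> hK; rewrite dag_sumE (big_cat_nat (n := K)) //=; last lia.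
apply: leq_add.
  rewrite big_distrr /=; apply: leq_sum => k _.
  rewrite mulnC -sum_nat_const_seq; apply: leq_sum => u _.
  by rewrite -sum1_size; apply: leq_sum => t _; case: (_ \in _).
rewrite big_nat_cond [X in _ <= X]big_nat_cond; apply: leq_sum => k /andP[hk _].
rewrite -sum_nat_const_seq big_seq_cond [X in _ <= X]big_seq_cond.
apply: leq_sum => u /andP[hu _].
have k0 : 0 < k by lia.
have := sum_occ k0 hu (N - k); rewrite subnKC; last lia.
move=> <-; apply: leq_sum => t _.
by rewrite /occ; case: (boolP (u \in _)); rewrite // -has_pred1 has_count.
Qed.

(** A Bonferroni inequality for sizes from [K] on; smaller subtrees are dropped. Doubling avoids
    halving the pair counts in [nat]. *)
Lemma dag_sum_ge m N K : 0 < K <= N ->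
  2 * \sum_(K <= k < N.+1) size (trees_of m k) * (m ^ (N - k) * cbin (N - k))
  <= 2 * dag_sum m N + \sum_(K <= k < N.+1 | k.*2 <= N)
       size (trees_of m k) * (m ^ (N - k.*2) * ((N - k.*2) * cbin (N - k.*2))).
Proof.
move=> hK; rewrite dag_sumE [X in _ <= 2 * X + _](big_cat_nat (n := K)) //=; last lia.
rewrite mulnDr -[X in _ <= X]addnA; apply: leq_trans (leq_addl _ _).
rewrite [X in _ <= _ + X]big_mkcond !big_distrr -big_split /=.
rewrite big_nat_cond [X in _ <= X]big_nat_cond; apply: leq_sum => k /andP[hk _].
have k0 : 0 < k by lia.
have -> : (if k.*2 <= N then size (trees_of m k) *
     (m ^ (N - k.*2) * ((N - k.*2) * cbin (N - k.*2))) else 0)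
  = \sum_(u <- trees_of m k) \sum_(t <- trees_of m N) occ u t * (occ u t).-1.
  have -> : (if k.*2 <= N then size (trees_of m k) *
     (m ^ (N - k.*2) * ((N - k.*2) * cbin (N - k.*2))) else 0)
   = \sum_(u <- trees_of m k)
      (if k.*2 <= N then (m ^ (N - k.*2) * ((N - k.*2) * cbin (N - k.*2))) else 0).
    by rewrite sum_nat_const_seq; case: ifP; rewrite ?muln0.
  apply: eq_big_seq => u hu; case: leqP => h.
    by have := sum_occ_pairs k0 hu (N - k.*2); rewrite subnKC // => ->.
  by rewrite (sum_occ_pairs_small k0 hu).
rewrite -sum_nat_const_seq !big_distrr -big_split /=.
rewrite big_seq_cond [X in _ <= X]big_seq_cond.
apply: leq_sum => u /andP[hu _].
have := sum_occ k0 hu (N - k); rewrite subnKC; last lia.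
move=> <-; rewrite !big_distrr -big_split /=; apply: leq_sum => t _.
case: (boolP (u \in _)) => [_|/count_memPn]; last by rewrite /occ => ->.
(* Here 2x <= 2 + x (x - 1), with equality at x = 1 and x = 2. *)
case: (occ u t) => [|[|[|x]]] //=; nia.
Qed.

Lemma sum_occ_large m K j :
  (K + j).+1 * (\sum_(K <= k < (K + j).+1)
     size (trees_of m k) * (m ^ (K + j - k) * cbin (K + j - k)))
  = m ^ (K + j) * (j.*2.+1 * cbin K * cbin j).
Proof.
rewrite -catalan_cbin_sum [RHS]mulnCA; congr (_ * _).
rewrite big_nat_rev -{1}[K]add0n big_addn subSn ?leq_addr // addKn big_mkord big_distrr /=.
apply: eq_bigr => i _; have hi := ltn_ord i.
have -> : K + (K + j).+1 - (i + K).+1 = K + j - i by lia.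
have -> : K + j - (K + j - i) = i by lia.
rewrite size_trees_of.
have -> : m ^ (K + j) = m ^ (K + j - i) * m ^ i by rewrite -expnD; congr (m ^ _); lia.
lia.
Qed.

Local Open Scope R_scope.

Lemma INR_addn a b : INR (a + b)%N = INR a + INR b.
Proof. exact: plus_INR. Qed.

Lemma INR_muln a b : INR (a * b)%N = INR a * INR b.
Proof. exact: mult_INR. Qed.

Lemma INR_expn a b : INR (a ^ b)%N = INR a ^ b.
Proof. by elim: b => //= b IHb; rewrite expnS INR_muln IHb. Qed.

Lemma INR_leq a b : (a <= b)%N -> INR a <= INR b.
Proof. by move=> h; apply: le_INR; lia. Qed.

Lemma INR_double a : INR a.*2 = 2 * INR a.
Proof. by rewrite -mul2n INR_muln. Qed.

(** * Wallis' bounds *)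

Definition wallis (n : nat) : R := RInt (fun x => sin x ^ n) 0 (PI / 2).

Lemma continuous_sin_pow n x : continuous (fun x => sin x ^ n) x.
Proof. by apply: ex_derive_continuous; auto_derive. Qed.

Lemma ex_RInt_sin_pow n : ex_RInt (fun x => sin x ^ n) 0 (PI / 2).
Proof. by apply: ex_RInt_continuous => x _; apply: continuous_sin_pow. Qed.

Lemma wallis0 : wallis 0 = PI / 2.
Proof. rewrite /wallis /= RInt_const /scal /= /mult /=; lra. Qed.

Lemma wallis1 : wallis 1 = 1.
Proof.
apply: is_RInt_unique.
have -> : 1 = minus (- cos (PI / 2)) (- cos 0).
  rewrite cos_PI2 cos_0 /minus /plus /opp /=; lra.
apply: (is_RInt_derive (fun x => - cos x)) => x _.
  by auto_derive => //; lra.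
exact: continuous_sin_pow.
Qed.

(** The difference of the two integrands is the derivative of [cos x * sin x ^ n.+1], which vanishes
    at both endpoints. *)
Lemma wallisSS n : (INR n + 2) * wallis n.+2 = (INR n + 1) * wallis n.
Proof.
have h : is_RInt (fun x => minus (scal (INR n + 1) (sin x ^ n))
    (scal (INR n + 2) (sin x ^ n.+2))) 0 (PI / 2) 0.
  have e : 0 = minus (cos (PI / 2) * sin (PI / 2) ^ n.+1) (cos 0 * sin 0 ^ n.+1).
    rewrite cos_PI2 sin_0 /minus /plus /opp /=; lra.
  rewrite {2}e.
  apply: (is_RInt_derive (fun x => cos x * sin x ^ n.+1)) => x _.
    auto_derive => //.
    have := sin2_cos2 x; rewrite /Rsqr /minus /plus /opp /scal /= /mult /= => sc.
    have -> : match n with 0%N => 1 | S _ => INR n + 1 end = INR n + 1.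
      by case: (n) => [|n'] //=; lra.
    have -> : 1 * - sin x * (sin x * sin x ^ n) + cos x * (1 * cos x * ((INR n + 1) * sin x ^ n))
       = sin x ^ n * ((INR n + 1) * (cos x * cos x) - sin x * sin x) by ring.
    have -> : cos x * cos x = 1 - sin x * sin x by lra.
    ring.
  apply: (@continuous_minus R_UniformSpace R_AbsRing R_NormedModule);
    apply: continuous_scal_r; exact: continuous_sin_pow.
have h' := is_RInt_minus _ _ _ _ _ _
  (is_RInt_scal _ _ _ (INR n + 1) _ (RInt_correct _ _ _ (ex_RInt_sin_pow n)))
  (is_RInt_scal _ _ _ (INR n + 2) _ (RInt_correct _ _ _ (ex_RInt_sin_pow n.+2))).
have := is_RInt_unique _ _ _ _ h; rewrite (is_RInt_unique _ _ _ _ h').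
rewrite -/(wallis n) -/(wallis n.+2) /minus /plus /opp /scal /= /mult /=; lra.
Qed.

Lemma wallis_decr n : wallis n.+1 <= wallis n.
Proof.
have hp := PI_RGT_0.
apply: RInt_le; [lra | exact: ex_RInt_sin_pow | exact: ex_RInt_sin_pow |].
move=> x hx /=.
have s0 : 0 <= sin x by apply: sin_ge_0; lra.
have s1 := SIN_bound x.
have := pow_le (sin x) n s0; nra.
Qed.

(** The probability that a simple random walk is back at 0 after [2k] steps. *)
Definition cprob (k : nat) : R := INR (cbin k) / 4 ^ k.

Lemma cprob_gt0 k : 0 < cprob k.
Proof.
apply: Rdiv_lt_0_compat; last by apply: pow_lt; lra.
by apply: lt_0_INR; have := cbin_gt0 k; lia.
Qed.

Lemma cprob0 : cprob 0 = 1.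
Proof. rewrite /cprob /cbin /=; lra. Qed.

Lemma cprobS k : 2 * (INR k + 1) * cprob k.+1 = (2 * INR k + 1) * cprob k.
Proof.
have := f_equal INR (cbinS k).
rewrite !INR_muln !S_INR INR_double /= => e.
have h4 : 4 ^ k <> 0 by apply: pow_nonzero; lra.
rewrite /cprob /=.
have -> : 2 * (INR k + 1) * (INR (cbin k.+1) / (4 * 4 ^ k))
  = ((INR k + 1) * INR (cbin k.+1)) / (2 * 4 ^ k) by field.
rewrite e; field => //.
Qed.

Lemma wallis_even k : wallis k.*2 = PI / 2 * cprob k.
Proof.
elim: k => [|k IHk]; first by rewrite wallis0 cprob0; lra.
have := wallisSS k.*2; rewrite doubleS IHk INR_double.
have := cprobS k; have := pos_INR k => hk e1 e2.
apply: (Rmult_eq_reg_l (2 * INR k + 2)); last lra.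
have -> : (2 * INR k + 2) * (PI / 2 * cprob k.+1)
  = PI / 2 * (2 * (INR k + 1) * cprob k.+1) by ring.
rewrite e1 e2; ring.
Qed.

Lemma wallis_odd k : (2 * INR k + 1) * wallis k.*2.+1 * cprob k = 1.
Proof.
elim: k => [|k IHk]; first by rewrite /= wallis1 cprob0; lra.
have := wallisSS k.*2.+1; rewrite doubleS !S_INR INR_double.
have := cprobS k; have := pos_INR k => hk e1 e2.
apply: (Rmult_eq_reg_l (2 * (INR k + 1))); last lra.
rewrite Rmult_1_r.
have -> : 2 * (INR k + 1) * ((2 * (INR k + 1) + 1) * wallis k.*2.+3 * cprob k.+1)
 = (2 * INR k + 1 + 2) * wallis k.*2.+3 * (2 * (INR k + 1) * cprob k.+1) by ring.
rewrite e1 e2.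
have -> : (2 * INR k + 1 + 1) * wallis k.*2.+1 * ((2 * INR k + 1) * cprob k)
 = (2 * INR k + 1 + 1) * ((2 * INR k + 1) * wallis k.*2.+1 * cprob k) by ring.
rewrite IHk; lra.
Qed.

(** Compare [wallis] at [2k + 1] and [2k]; the upper bound below compares it at [2k + 2] and
    [2k + 1]. *)
Lemma cprob_sqr_ge k : 1 <= PI * (INR k + 1) * (cprob k * cprob k).
Proof.
have := wallis_decr k.*2; rewrite wallis_even => h.
have o := wallis_odd k; have b0 := cprob_gt0 k; have k0 := pos_INR k.
have hp := PI_RGT_0.
have : (2 * INR k + 1) * cprob k * wallis k.*2.+1
   <= (2 * INR k + 1) * cprob k * (PI / 2 * cprob k).
  apply: Rmult_le_compat_l h; nra.
have : 0 <= PI * (cprob k * cprob k) by nra.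
nra.
Qed.

Lemma cprob_sqr_le k : PI * INR k * (cprob k * cprob k) <= 1.
Proof.
case: k => [|k]; first by rewrite /=; lra.
have := wallis_decr k.*2.+1; rewrite -doubleS wallis_even S_INR => h.
have o := wallis_odd k; have b0 := cprob_gt0 k; have k0 := pos_INR k.
have e := cprobS k; have b1 := cprob_gt0 k.+1.
have : (2 * INR k + 1) * cprob k * (PI / 2 * cprob k.+1)
  <= (2 * INR k + 1) * cprob k * wallis k.*2.+1.
  apply: Rmult_le_compat_l h; nra.
have -> : (2 * INR k + 1) * cprob k * wallis k.*2.+1 = 1 by lra.
rewrite -e; lra.
Qed.

Lemma cprob_decr a b : (a <= b)%N -> cprob b <= cprob a.
Proof.
move/subnK <-; elim: (b - a)%N => [|d IHd]; first exact: Rle_refl.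
apply: Rle_trans IHd; rewrite addSn.
have := cprobS (d + a); have := cprob_gt0 (d + a); have := pos_INR (d + a).
have := cprob_gt0 (d + a).+1; nra.
Qed.

Lemma cprob_le1 k : cprob k <= 1.
Proof. by rewrite -cprob0; apply: cprob_decr. Qed.

Lemma mul_cprob_incr a b : (a <= b)%N -> INR a * cprob a <= INR b * cprob b.
Proof.
move/subnK <-; elim: (b - a)%N => [|d IHd]; first exact: Rle_refl.
apply: Rle_trans IHd _; rewrite addSn S_INR.
have := cprobS (d + a); have := cprob_gt0 (d + a); have := pos_INR (d + a).
nra.
Qed.

Lemma odd_mul_cprob_incr a b : (a <= b)%N ->
  (2 * INR a + 1) * cprob a <= (2 * INR b + 1) * cprob b.
Proof.
move/subnK <-; elim: (b - a)%N => [|d IHd]; first exact: Rle_refl.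
apply: Rle_trans IHd _; rewrite addSn S_INR.
have := cprobS (d + a); have := cprob_gt0 (d + a).+1; have := pos_INR (d + a).
nra.
Qed.

(** Gives a bound on [cprob k] that also covers [k = 0]. The induction rests on (k + 2) (2k + 1)^2
    <= 4 (k + 1)^3. *)
Lemma cprob_sqr_le_succ k : (INR k + 1) * (cprob k * cprob k) <= 1.
Proof.
elim: k => [|k IHk]; first by rewrite cprob0 /=; lra.
have e := cprobS k; have k0 := pos_INR k; rewrite S_INR.
have b0 := cprob_gt0 k; have b1 := cprob_gt0 k.+1.
have e2 : 4 * (INR k + 1) ^ 2 * (cprob k.+1 * cprob k.+1)
  = (2 * INR k + 1) ^ 2 * (cprob k * cprob k).
  have -> : 4 * (INR k + 1) ^ 2 * (cprob k.+1 * cprob k.+1)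
   = (2 * (INR k + 1) * cprob k.+1) ^ 2 by ring.
  rewrite e; ring.
apply: (Rmult_le_reg_l (4 * (INR k + 1) ^ 3)).
  apply: Rmult_lt_0_compat; [lra | apply: pow_lt; lra].
have -> : 4 * (INR k + 1) ^ 3 * ((INR k + 1 + 1) * (cprob k.+1 * cprob k.+1))
  = (INR k + 1) * (INR k + 2) * (4 * (INR k + 1) ^ 2 * (cprob k.+1 * cprob k.+1)) by ring.
rewrite e2.
have -> : (INR k + 1) * (INR k + 2) * ((2 * INR k + 1) ^ 2 * (cprob k * cprob k))
  = (INR k + 2) * (2 * INR k + 1) ^ 2 * ((INR k + 1) * (cprob k * cprob k)) by ring.
apply: (Rle_trans _ ((INR k + 2) * (2 * INR k + 1) ^ 2 * 1)).
  apply: Rmult_le_compat_l IHk; nra.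
nra.
Qed.

(** * Error terms *)

(* Every error term is bounded by a multiple of [n * decay K]. *)
Definition decay (k : nat) : R := / ((INR k + 1) * sqrt (INR k + 1)).

Lemma decay_gt0 k : 0 < decay k.
Proof.
have k0 := pos_INR k; apply: Rinv_0_lt_compat; apply: Rmult_lt_0_compat; first lra.
by apply: sqrt_lt_R0; lra.
Qed.

Lemma decay_decr k : decay k.+1 <= decay k.
Proof.
have k0 := pos_INR k; apply: Rinv_le_contravar.
  apply: Rmult_lt_0_compat; first lra.
  by apply: sqrt_lt_R0; lra.
rewrite S_INR; apply: Rmult_le_compat; try lra; first exact: sqrt_pos.
by apply: sqrt_le_1_alt; lra.
Qed.

(** The quotient is at most 2^(3/2), which is below 3. *)
Lemma decay_le_mul3 k : decay k <= 3 * decay k.+1.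
Proof.
have k0 := pos_INR k; rewrite /decay S_INR.
have s1 : 0 < sqrt (INR k + 1) by apply: sqrt_lt_R0; lra.
have s2 : 0 < sqrt (INR k + 1 + 1) by apply: sqrt_lt_R0; lra.
have q1 := sqrt_sqrt (INR k + 1) ltac:(lra).
have q2 := sqrt_sqrt (INR k + 1 + 1) ltac:(lra).
set u := sqrt (INR k + 1) in s1 q1 *; set v := sqrt (INR k + 1 + 1) in s2 q2 *.
have h : (INR k + 1 + 1) * v <= 3 * ((INR k + 1) * u).
  apply: Rsqr_incr_0; rewrite /Rsqr; [|nra|nra].
  have -> : (INR k + 1 + 1) * v * ((INR k + 1 + 1) * v) = (INR k + 1 + 1) ^ 2 * (v * v) by ring.
  have -> : 3 * ((INR k + 1) * u) * (3 * ((INR k + 1) * u)) = 9 * (INR k + 1) ^ 2 * (u * u) by ring.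
  rewrite q1 q2; nra.
have p1 : 0 < (INR k + 1) * u by nra.
have p2 : 0 < (INR k + 1 + 1) * v by nra.
apply: (Rmult_le_reg_l ((INR k + 1) * u * ((INR k + 1 + 1) * v))); first nra.
have -> : (INR k + 1) * u * ((INR k + 1 + 1) * v) * / ((INR k + 1) * u)
  = (INR k + 1 + 1) * v by field; lra.
have -> : (INR k + 1) * u * ((INR k + 1 + 1) * v) * (3 * / ((INR k + 1 + 1) * v))
  = 3 * ((INR k + 1) * u) by field; lra.
exact: h.
Qed.

Lemma cprob_div_le_decay k : cprob k / (INR k + 1) <= decay k.
Proof.
have k0 := pos_INR k; have b0 := cprob_gt0 k; have h := cprob_sqr_le_succ k.
have s1 : 0 < sqrt (INR k + 1) by apply: sqrt_lt_R0; lra.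
have q1 := sqrt_sqrt (INR k + 1) ltac:(lra).
rewrite /decay Rinv_mult /Rdiv [X in X <= _]Rmult_comm; apply: Rmult_le_compat_l.
  by apply/Rlt_le/Rinv_0_lt_compat; lra.
apply: (Rmult_le_reg_l (sqrt (INR k + 1))) => //; rewrite Rinv_r; last lra.
apply: Rsqr_incr_0; rewrite /Rsqr; [|nra|lra].
set u := sqrt (INR k + 1) in s1 q1 *.
have -> : u * cprob k * (u * cprob k) = (u * u) * (cprob k * cprob k) by ring.
rewrite q1; lra.
Qed.

Lemma INR_size_trees_of m k :
  INR (size (trees_of m k)) = (4 * INR m) ^ k * (cprob k / (INR k + 1)).
Proof.
rewrite size_trees_of INR_muln INR_expn /cprob Rpow_mult_distr.
have := f_equal INR (catalanM k); rewrite INR_muln S_INR => <-.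
have k0 := pos_INR k; have h4 : 4 ^ k <> 0 by apply: pow_nonzero; lra.
by field; split => //; lra.
Qed.

Lemma sum_size_trees_le m K : (0 < m)%N ->
  INR (\sum_(0 <= k < K) size (trees_of m k)) <= 3 * (4 * INR m) ^ K * decay K.
Proof.
move=> m0; have hm : 1 <= INR m by apply: (INR_leq (a := 1)).
elim: K => [|K IHK].
  rewrite big_nil /=; have := decay_gt0 0; lra.
rewrite big_nat_recr //= INR_addn INR_size_trees_of.
have hq : 0 < (4 * INR m) ^ K by apply: pow_lt; lra.
have := cprob_div_le_decay K; have := decay_le_mul3 K; have := decay_gt0 K.+1.
set q := _ ^ K in IHK hq *; set x := decay K in IHK *; set y := decay K.+1.
move: (cprob K / _) => z y0 xy zx.
(* The sum is at most 3qx + qx = 4qx <= 12qy, and 12 <= 3 (4m) closes the induction. *)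
apply: (Rle_trans _ (12 * q * y)).
  have : q * z <= q * x by nra.
  nra.
have : q * y <= INR m * (q * y) by have : 0 < q * y by [nra]; nra.
nra.
Qed.

Lemma size_trees_of_gt0 m N : (0 < m)%N -> 0 < INR (size (trees_of m N)).
Proof.
move=> m0; have hm : 1 <= INR m by apply: (INR_leq (a := 1)).
rewrite INR_size_trees_of; apply: Rmult_lt_0_compat; first by apply: pow_lt; lra.
by apply: Rdiv_lt_0_compat; [exact: cprob_gt0 | have := pos_INR N; lra].
Qed.

Lemma occ_large_ratio m K j : (0 < m)%N ->
  INR (\sum_(K <= k < (K + j).+1)
     size (trees_of m k) * (m ^ (K + j - k) * cbin (K + j - k)))%N
   / INR (size (trees_of m (K + j)))
  = (2 * INR j + 1) * cprob K * cprob j / cprob (K + j).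
Proof.
move=> m0; have hm : 1 <= INR m by apply: (INR_leq (a := 1)).
have := f_equal INR (sum_occ_large m K j).
rewrite INR_size_trees_of !INR_muln INR_expn !S_INR INR_double.
set S := INR (\sum_(_ <= _ < _) _); move=> e.
have N0 := pos_INR (K + j).
have hcb k : INR (cbin k) = 4 ^ k * cprob k.
  by rewrite /cprob; field; apply: pow_nonzero; lra.
have -> : S = INR m ^ (K + j) * ((2 * INR j + 1) * INR (cbin K) * INR (cbin j)) / (INR (K + j) + 1).
  by rewrite -e; field; lra.
rewrite !hcb Rpow_mult_distr (pow_add 4).
have := cprob_gt0 (K + j) => b0.
have : INR m ^ (K + j) <> 0 by apply: pow_nonzero; lra.
have : 4 ^ K <> 0 by apply: pow_nonzero; lra.
have : 4 ^ j <> 0 by apply: pow_nonzero; lra.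
move=> *; field.
by do !split => //; lra.
Qed.

(** Below, [cprob] decreases; above, [(2 j + 1) cprob j] increases with [j]. *)
Lemma occ_large_bounds K j :
  (2 * INR j + 1) * cprob K <= (2 * INR j + 1) * cprob K * cprob j / cprob (K + j)
  <= (2 * INR (K + j) + 1) * cprob K.
Proof.
have bN := cprob_gt0 (K + j); have bj := cprob_gt0 j; have bK := cprob_gt0 K.
have j0 := pos_INR j.
split.
  apply: (proj1 (Rle_div_r _ _ _ bN)); apply: Rmult_le_compat_l; first nra.
  exact/cprob_decr/leq_addl.
apply: (proj2 (Rle_div_l _ _ _ bN)).
have := odd_mul_cprob_incr (leq_addl K j); nra.
Qed.

(** The powers of [4m] have exponents [k] and [N - 2k] against [N], leaving [-k]. Monotonicity of
    [j * cprob j] replaces [N - 2k] by [N], and the factor [N + 1] cancels the Catalan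
    denominator. *)
Lemma pair_term_le m k N : (0 < m)%N -> (k.*2 <= N)%N ->
  INR (size (trees_of m k) * (m ^ (N - k.*2) * ((N - k.*2) * cbin (N - k.*2))))%N
  <= INR (size (trees_of m N)) * (INR N * (INR N + 1)) * (decay k * (/ (4 * INR m)) ^ k).
Proof.
move=> m0 hk; have hm : 1 <= INR m by apply: (INR_leq (a := 1)).
rewrite !INR_muln !INR_size_trees_of INR_expn.
set j := (N - k.*2)%N.
have eN : N = (k + k + j)%N by rewrite /j; lia.
have hcb : INR (cbin j) = 4 ^ j * cprob j.
  by rewrite /cprob; field; apply: pow_nonzero; lra.
rewrite hcb.
have jN : (j <= N)%N by lia.
have := mul_cprob_incr jN; have := cprob_div_le_decay k.
have bN := cprob_gt0 N; have bk := cprob_gt0 k; have k0 := pos_INR k; have N0 := pos_INR N.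
have z0 : 0 < cprob k / (INR k + 1) by apply: Rdiv_lt_0_compat; lra.
have bj := cprob_gt0 j; have j0 := pos_INR j.
move: (cprob k / _) z0 => z z0 zx hj.
have q0 : 0 < 4 * INR m by lra.
have -> : (4 * INR m) ^ N * (cprob N / (INR N + 1)) * (INR N * (INR N + 1)) *
   (decay k * (/ (4 * INR m)) ^ k)
  = (4 * INR m) ^ k * (4 * INR m) ^ j * (decay k * (INR N * cprob N)).
  rewrite {1}eN !pow_add pow_inv; field.
  by split; [apply: pow_nonzero|]; lra.
have -> : (4 * INR m) ^ k * z * (INR m ^ j * (INR j * (4 ^ j * cprob j)))
  = (4 * INR m) ^ k * (4 * INR m) ^ j * (z * (INR j * cprob j)).
  rewrite (Rpow_mult_distr 4 (INR m) j); ring.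
apply: Rmult_le_compat_l.
  by apply: Rmult_le_pos; apply: pow_le; lra.
by apply: Rmult_le_compat => //; [lra | nra].
Qed.

Lemma pair_sum_le m N K M : (0 < m)%N ->
  INR (\sum_(K <= k < M | (k.*2 <= N)%N)
       size (trees_of m k) * (m ^ (N - k.*2) * ((N - k.*2) * cbin (N - k.*2))))%N
  <= INR (size (trees_of m N)) * (INR N * (INR N + 1))
      * (4 / 3 * decay K * (/ (4 * INR m)) ^ K).
Proof.
move=> m0; have hm : 1 <= INR m by apply: (INR_leq (a := 1)).
have N0 := pos_INR N; have c0 := size_trees_of_gt0 N m0.
set D := INR (size _) * _.
have D0 : 0 <= D by rewrite /D; nra.
set p := / (4 * INR m).
have p0 : 0 < p by apply: Rinv_0_lt_compat; lra.
have p4 : p <= 1 / 4.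
  by rewrite /p -[1 / 4]/(1 * / 4) Rmult_1_l; apply: Rinv_le_contravar; lra.
have dK := decay_gt0 K.
have pK k : 0 < p ^ k by apply: pow_lt.
case: (leqP M K) => hMK.
  rewrite big_geq //=; apply: Rmult_le_pos => //.
  have := pK K; nra.
(* A geometric sum of ratio at most 1/4, whence 4/3. Subtracting the tail [p ^ (K + d)] makes the
   bound inductive. *)
suff h d : INR (\sum_(K <= k < K + d | (k.*2 <= N)%N)
       size (trees_of m k) * (m ^ (N - k.*2) * ((N - k.*2) * cbin (N - k.*2))))%N
  <= D * (4 / 3 * decay K * (p ^ K - p ^ (K + d))).
  have := h (M - K)%N; rewrite subnKC; last lia.
  move/Rle_trans; apply; apply: Rmult_le_compat_l => //.
  have := pK M; nra.
elim: d => [|d IHd].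
  rewrite addn0 big_geq //=; nra.
rewrite addnS big_mkcond big_nat_recr /= ?leq_addr // -big_mkcond INR_addn.
have dd : decay (K + d) <= decay K.
  elim: d {IHd} => [|d IHd]; first by rewrite addn0; exact: Rle_refl.
  by rewrite addnS; apply: Rle_trans (decay_decr _) IHd.
have ht : INR (if (((K + d).*2) <= N)%N then
     size (trees_of m (K + d)) * (m ^ (N - (K + d).*2) * ((N - (K + d).*2) * cbin (N - (K + d).*2)))
     else 0)%N <= D * (decay K * p ^ (K + d)).
  have pp := pK (K + d)%N.
  case: ifP => hk.
    apply: Rle_trans (pair_term_le m0 hk) _; apply: Rmult_le_compat_l => //.
    by rewrite -/p; nra.
  by apply: Rmult_le_pos => //; nra.
apply: Rle_trans (Rplus_le_compat _ _ _ _ IHd ht) _.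
rewrite -Rmult_plus_distr_l; apply: Rmult_le_compat_l => //=.
have pp := pK (K + d)%N.
have : decay K * (p * p ^ (K + d)) <= decay K * (1 / 4 * p ^ (K + d)).
  by apply: Rmult_le_compat_l; nra.
nra.
Qed.

Lemma PI_ge1 : 1 <= PI.
Proof. have := PI2_1; lra. Qed.

(** The hypotheses give u >= 1 / sqrt (PI (K + 1)) and v <= 1 / sqrt (PI K). It is used twice with
    the roles exchanged, to bound an absolute value. *)
Lemma sqrt_inv_gap K u v : (0 < K)%N -> 0 < u -> 0 < v ->
  1 <= PI * (INR K + 1) * (u * u) -> PI * INR K * (v * v) <= 1 ->
  v - u <= 3 * decay K.
Proof.
case: K => // k _ u0 v0 hu hv; apply: Rle_trans (decay_le_mul3 k); rewrite /decay.
move: hu hv; rewrite S_INR; have := pos_INR k; move: (INR k) => x x0 hu hv.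
have hp := PI_ge1.
have s1 : 1 <= sqrt PI by rewrite -sqrt_1; apply: sqrt_le_1_alt.
have sq := sqrt_sqrt PI ltac:(lra).
have a0 : 0 < sqrt (x + 1) by apply: sqrt_lt_R0; lra.
have aq := sqrt_sqrt (x + 1) ltac:(lra).
have b0 : 0 < sqrt (x + 1 + 1) by apply: sqrt_lt_R0; lra.
have bq := sqrt_sqrt (x + 1 + 1) ltac:(lra).
set s := sqrt PI in s1 sq; set a := sqrt (x + 1) in a0 aq *.
set b := sqrt (x + 1 + 1) in b0 bq.
rewrite -aq; rewrite -sq -bq in hu; rewrite -sq -aq in hv.
have ab : a <= b by apply: sqrt_le_1_alt; lra.
have hu' : 1 <= s * b * u.
  apply: Rsqr_incr_0; rewrite /Rsqr; [nra|lra|].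
  by apply: Rmult_le_pos; nra.
have hv' : s * a * v <= 1.
  apply: Rsqr_incr_0; rewrite /Rsqr; [nra| |lra].
  by apply: Rmult_le_pos; nra.
have hu2 : / (s * b) <= u.
  apply: (Rmult_le_reg_l (s * b)); first nra.
  rewrite Rinv_r; nra.
have hv2 : v <= / (s * a).
  apply: (Rmult_le_reg_l (s * a)); first nra.
  rewrite Rinv_r; nra.
(* Since b^2 - a^2 = 1, the difference is 1 / (a b (a + b)). *)
have gap : / a - / b <= / (a * a * a).
  have a3 : 0 < a * a * a by apply: Rmult_lt_0_compat; nra.
  apply: (Rmult_le_reg_l (a * a * a * b)); first nra.
  have -> : a * a * a * b * (/ a - / b) = a * a * (b - a) by field; lra.
  have -> : a * a * a * b * / (a * a * a) = b by field; lra.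
  have e : (b - a) * (b + a) = 1 by lra.
  have : a * (b - a) <= 1 by nra.
  nra.
have ha : 0 <= / a - / b.
  by have := Rinv_le_contravar _ _ a0 ab; lra.
have e : / (s * a) - / (s * b) = / s * (/ a - / b) by field; lra.
have s1' : / s <= 1 by rewrite -[1]Rinv_1; apply: Rinv_le_contravar; lra.
have s0' : 0 < / s by apply: Rinv_0_lt_compat; lra.
nra.
Qed.

(** The cube grows by a factor of at most 4 only from [K = 1] on, so 0 and 1 are checked separately;
    equality at 1 fixes the constant 2. *)
Lemma cube_le_pow4 K : (INR K + 1) ^ 3 <= 2 * 4 ^ K.
Proof.
case: K => [|K]; first by rewrite /=; lra.
elim: K => [|K IHK]; first by rewrite /=; lra.
move: IHK; rewrite !S_INR -[4 ^ K.+2]/(4 * 4 ^ K.+1) => IHK.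
have k0 := pos_INR K; move: (INR K) (4 ^ K.+1) k0 IHK => x y x0 h.
apply: (Rle_trans _ (4 * (x + 1 + 1) ^ 3)); last lra.
nra.
Qed.

Lemma succ_le_decay (K : nat) y : 4 ^ K <= y -> INR K + 1 <= 2 * (y * decay K).
Proof.
move=> hy; have k0 := pos_INR K; have := cube_le_pow4 K; rewrite /decay.
have s0 : 1 <= sqrt (INR K + 1) by rewrite -{1}sqrt_1; apply: sqrt_le_1_alt; lra.
have sq := sqrt_sqrt (INR K + 1) ltac:(lra).
move: (sqrt _) s0 sq => s s0 sq h.
have e : 2 * (y * / ((INR K + 1) * s)) = (2 * y) / ((INR K + 1) * s) by rewrite /Rdiv; ring.
have d0 : 0 < (INR K + 1) * s by nra.
rewrite e; apply: (proj1 (Rle_div_r _ _ _ d0)).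
have : s <= INR K + 1 by nra.
nra.
Qed.

(** * The average size of the minimal dag *)

Lemma NbarE m n : Nbar m n = INR (dag_sum m n.+1) / INR (size (trees_of m n.+1)).
Proof. by rewrite /Nbar labeled_treesE sumnE big_map. Qed.

Lemma Nbar_bounds m n K : (0 < m)%N -> (0 < n)%N -> (0 < K <= n)%N ->
  Rabs (Nbar m n - 2 * INR n * cprob K) <=
  3 * (4 * INR m) ^ K * decay K
  + 4 * (INR n * INR n) * (decay K * (/ (4 * INR m)) ^ K) + 3 * (INR K + 1).
Proof.
move=> m0 n0 hK; have hm : 1 <= INR m by apply: (INR_leq (a := 1)).
have hn : 1 <= INR n by apply: (INR_leq (a := 1)).
have hKN : (0 < K <= n.+1)%N by lia.
have c0 := size_trees_of_gt0 n.+1 m0.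
have up := INR_leq (dag_sum_le m hKN).
have lo := INR_leq (dag_sum_ge m hKN).
have eN : (K + (n.+1 - K) = n.+1)%N by lia.
have main := occ_large_ratio K (n.+1 - K) m0.
have := occ_large_bounds K (n.+1 - K).
rewrite -main eN => -[Ml Mu].
have pr := pair_sum_le n.+1 K n.+2 m0.
have sm := sum_size_trees_le K m0.
move: up lo; rewrite !INR_addn !INR_muln -[INR 0]/0 NbarE => up lo.
move: Ml Mu up lo pr sm.
set A := INR (\sum_(0 <= k < K) _); set S := INR (\sum_(K <= k < n.+2) _).
set Q := INR (\sum_(K <= k < n.+2 | _) _).
set c := INR (size _); set D := INR (dag_sum _ _).
set p := (/ _) ^ K; set q := _ ^ K => Ml Mu up lo pr sm.
have b0 := cprob_gt0 K; have b1 := cprob_le1 K; have k0 := pos_INR K.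
have jE : INR (n.+1 - K) = INR n + 1 - INR K.
  by have := f_equal INR eN; rewrite INR_addn S_INR; lra.
rewrite jE in Ml; rewrite S_INR in Mu pr.
have p0 : 0 < p by apply: pow_lt; apply: Rinv_0_lt_compat; lra.
have dp : 0 < decay K * p by have := decay_gt0 K; nra.
have hS : S = S / c * c by field; rewrite /c; lra.
have hD : D = D / c * c by field; rewrite /c; lra.
have up' : D / c <= A + S / c.
  apply: (Rmult_le_reg_r c) => //; rewrite -hD; lra.
(* From [n >= 1], 4/3 (n + 1) (n + 2) <= 8 n^2; the doubling in [dag_sum_ge] then leaves 4. *)
have pr' : Q <= c * (8 * (INR n * INR n) * (decay K * p)).
  apply: Rle_trans pr _; rewrite Rmult_assoc; apply: Rmult_le_compat_l; first exact: Rlt_le.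
  have -> : (INR n + 1) * (INR n + 1 + 1) * (4 / 3 * decay K * p)
    = 4 / 3 * ((INR n + 1) * (INR n + 1 + 1)) * (decay K * p) by ring.
  apply: Rmult_le_compat_r; [lra | nra].
have lo' : S / c <= D / c + 4 * (INR n * INR n) * (decay K * p).
  apply: (Rmult_le_reg_r c) => //; rewrite Rmult_plus_distr_r -hD -hS; lra.
have A0 : 0 <= A by exact: pos_INR.
(* The coefficient of [cprob K] in the main term lies between 2n + 3 - 2K and 2n + 3, so with
   [cprob K <= 1] replacing it by 2n costs at most 3 (K + 1). *)
apply: Rabs_le; split; nra.
Qed.

(** The small trees give 3, the pairs 4 (4m), and [3 (K + 1)] gives 6 by [succ_le_decay]. *)
Lemma Nbar_decay m n K : (0 < m)%N -> (0 < K)%N ->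
  (4 * INR m) ^ K <= INR n <= (4 * INR m) ^ K.+1 ->
  Rabs (Nbar m n - 2 * INR n * cprob K) <= (9 + 16 * INR m) * (INR n * decay K).
Proof.
move=> m0 K0 [ql qu]; have hm : 1 <= INR m by apply: (INR_leq (a := 1)).
have h4 : 4 ^ K <= INR n by apply: Rle_trans ql; apply: pow_incr; lra.
have Kn : (K <= n)%N.
  have : INR K < INR n.
    apply: Rlt_le_trans h4; elim: (K) => [|k IHk]; first by rewrite /=; lra.
    rewrite S_INR /=; have : 1 <= 4 ^ k by apply: pow_R1_Rle; lra.
    lra.
  by move/INR_lt; lia.
have dK := decay_gt0 K; have sd := succ_le_decay h4.
have q0 : 0 < (4 * INR m) ^ K by apply: pow_lt; lra.
have pE : (/ (4 * INR m)) ^ K = / (4 * INR m) ^ K by rewrite pow_inv.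
apply: Rle_trans (Nbar_bounds m0 _ _) _; [lia|lia|].
have h1 : (4 * INR m) ^ K * decay K <= INR n * decay K by nra.
have h2 : INR n * (/ (4 * INR m)) ^ K <= 4 * INR m.
  rewrite pE; apply: (proj2 (Rle_div_l _ _ _ q0)); exact: qu.
have h3 : (INR n * (/ (4 * INR m)) ^ K) * (INR n * decay K) <= 4 * INR m * (INR n * decay K).
  by apply: Rmult_le_compat_r h2; nra.
lra.
Qed.

Theorem theorem6 (m : nat) (Hm : (1 <= m)%N) :
  exists C : R, exists N : nat, forall n : nat, (N <= n)%N ->
    (Rabs (Nbar m n - 2 * kappa m * (INR n / sqrt (ln (INR n))))
       <= C * (INR n / sqrt (ln (INR n))) / ln (INR n))%R.
Proof.
have hm : 1 <= INR m by apply: (INR_leq (a := 1)).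
have lam0 : 0 < ln (4 * INR m) by rewrite -ln_1; apply: ln_increasing; lra.
set lam := ln (4 * INR m) in lam0.
(* To 9 + 16m from [Nbar_decay], the gap between [cprob K] and its limit form adds 2 * 3. The
   threshold [4m] ensures [K >= 1]. *)
exists ((15 + 16 * INR m) * (lam * sqrt lam)), (4 * m)%N => n hn.
set K := trunc_log (4 * m) n.
have q1 : (1 < 4 * m)%N by lia.
have n0 : (0 < n)%N by lia.
have K0 : (0 < K)%N by rewrite /K trunc_log_gt0; lia.
have qE : INR (4 * m) = 4 * INR m by rewrite INR_muln /=; lra.
have ql : (4 * INR m) ^ K <= INR n.
  by rewrite -qE -INR_expn; apply/INR_leq/trunc_logP.
have qu : (4 * INR m) ^ K.+1 >= INR n.
  by apply/Rle_ge; rewrite -qE -INR_expn; apply/INR_leq/ltnW/trunc_log_ltn.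
have nR : 1 <= INR n by apply: (INR_leq (a := 1)).
have Ll : INR K * lam <= ln (INR n).
  rewrite -ln_pow; last lra.
  by apply: ln_le => //; apply: pow_lt; lra.
have Lu : ln (INR n) <= (INR K + 1) * lam.
  rewrite -S_INR -ln_pow; last lra.
  by apply: ln_le; lra.
have main := Nbar_decay Hm K0 (conj ql (Rge_le _ _ qu)).
have K1 : 1 <= INR K by apply: (INR_leq (a := 1)).
have hp := PI_ge1; have dK := decay_gt0 K.
set L := ln (INR n) in Ll Lu *.
have L0 : 0 < L by nra.
have sL0 : 0 < sqrt L by apply: sqrt_lt_R0.
have sLq := sqrt_sqrt L ltac:(lra).
have k0 : 0 < kappa m.
  by apply: sqrt_lt_R0; rewrite -/lam; apply: Rdiv_lt_0_compat; lra.
have kq : kappa m * kappa m = lam / PI.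
  by apply: sqrt_sqrt; rewrite -/lam; apply/Rlt_le/Rdiv_lt_0_compat; lra.
(* The square of [v] is lam / (PI L), and L / lam lies between [K] and [K + 1]. So [v] satisfies the
   same Wallis bounds as [cprob K]. *)
set v := kappa m / sqrt L.
have v0 : 0 < v by apply: Rdiv_lt_0_compat.
have vq : PI * (v * v) = lam / L.
  have -> : v * v = (kappa m * kappa m) / (sqrt L * sqrt L) by rewrite /v; field; lra.
  rewrite kq sLq; field; lra.
have vK1 : 1 <= PI * (INR K + 1) * (v * v).
  have -> : PI * (INR K + 1) * (v * v) = (INR K + 1) * lam / L.
    by rewrite Rmult_assoc [(_ + 1) * _]Rmult_comm -Rmult_assoc vq; field; lra.
  by apply: (proj1 (Rle_div_r _ _ _ L0)); lra.
have vK : PI * INR K * (v * v) <= 1.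
  have -> : PI * INR K * (v * v) = INR K * lam / L.
    by rewrite Rmult_assoc [INR K * _]Rmult_comm -Rmult_assoc vq; field; lra.
  by apply: (proj2 (Rle_div_l _ _ _ L0)); lra.
have gap : Rabs (cprob K - v) <= 3 * decay K.
  have b0 := cprob_gt0 K.
  have := sqrt_inv_gap K0 v0 b0 vK1 (cprob_sqr_le K).
  have := sqrt_inv_gap K0 b0 v0 (cprob_sqr_ge K) vK.
  by move=> *; apply: Rabs_le; split; lra.
have -> : 2 * kappa m * (INR n / sqrt L) = 2 * INR n * v by rewrite /v; field; lra.
have -> : Nbar m n - 2 * INR n * v
  = (Nbar m n - 2 * INR n * cprob K) + 2 * INR n * (cprob K - v) by ring.
apply: Rle_trans (Rabs_triang _ _) _.
rewrite Rabs_mult (Rabs_pos_eq (2 * INR n)); last lra.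
apply: (Rle_trans _ ((15 + 16 * INR m) * (INR n * decay K))).
  by have : 2 * INR n * Rabs (cprob K - v) <= 2 * INR n * (3 * decay K); [nra | lra].
(* This is K + 1 >= L / lam raised to the power -3/2. *)
have dL : decay K <= lam * sqrt lam / (L * sqrt L).
  have sl0 : 0 < sqrt lam by apply: sqrt_lt_R0.
  have sk0 : 0 < sqrt (INR K + 1) by apply: sqrt_lt_R0; lra.
  have LL0 : 0 < L * sqrt L by nra.
  apply: (proj1 (Rle_div_r _ _ _ LL0)).
  rewrite /decay Rmult_comm; apply: (proj2 (Rle_div_l _ _ _ _)); first nra.
  have sL : sqrt L <= sqrt (INR K + 1) * sqrt lam.
    by rewrite -sqrt_mult_alt; [apply: sqrt_le_1_alt | lra].
  have := Rmult_le_compat _ _ _ _ (Rlt_le _ _ L0) (Rlt_le _ _ sL0) Lu sL.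
  lra.
have -> : (15 + 16 * INR m) * (lam * sqrt lam) * (INR n / sqrt L) / L
  = (15 + 16 * INR m) * (INR n * (lam * sqrt lam / (L * sqrt L))) by field; lra.
apply: Rmult_le_compat_l; first lra.
by apply: Rmult_le_compat_l; first lra.
Qed.
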